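(* Let $0<\mu<L$ and let $f:\mathbb{R}^d\to\mathbb{R}$ be $\mu$-strongly convex and $L$-smooth. Consider minimizing $f$ with Nesterov's accelerated gradient method (NAG) with gradient errors $w_k\in\mathbb{R}^d$, $$x_{k+1}=x_k-\alpha(\nabla f(y_k)+w_k)+\beta(x_k-x_{k-1}),\qquad y_k=x_k+\beta(x_k-x_{k-1}),$$ with constant stepsize $\alpha\in(0,1/L]$, $\beta=\frac{1-\sqrt{\alpha\mu}}{1+\sqrt{\alpha\mu}}$ and initialization $x_0=x_{-1}\in\mathbb{R}^d$. The worst-case robustness of the NAG method satisfies the upper bound $$L_{2,*}\le\overline{L}_{NAG}(\alpha):=\sqrt{\frac{4(5-2\sqrt{\alpha\mu}+\alpha\mu)}{\mu(1+\sqrt{\alpha\mu})^2}+\frac{\sqrt\alpha(1+\alpha L)}{\sqrt\mu}+\frac{8\alpha^3L^4\big(4+(1-\sqrt{\alpha\mu})^2\big)}{\mu^2(1+\sqrt{\alpha\mu})^2}},$$ and $\overline{L}_{NAG}(\alpha)=\frac{2\sqrt5}{\sqrt\mu}+\mathcal{O}(\sqrt\alpha)$ as $\alpha\to0$.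
   Context: $L$-smooth means $f$ is continuously differentiable with $L$-Lipschitz gradient; $\mu$-strongly convex means $x\mapsto f(x)-\frac\mu2\|x\|^2$ is convex. $x_*$ is the minimizer of $f$. $\ell_2$ gain (worst-case robustness): $L_{2,*}$ is the infimum of all $\gamma>0$ for which there is a function $\overline H:\mathbb{R}^d\to[0,\infty)$, independent of the error sequence, with $\overline H(x_* )=0$, such that for every initialization $x_0=x_{-1}\in\mathbb{R}^d$ and every square-summable $\{w_k\}_{k\ge0}\subset\mathbb{R}^d$, $$\sum_{k\ge0}(f(x_k)-f(x_* ))\le\gamma^2\sum_{k\ge0}\|w_k\|^2+\overline H(x_0).$$ *)

(* Defs.v *)
From HB Require Import structures.
From mathcomp Require Import all_boot all_order all_algebra.
From mathcomp Require Import all_classical all_reals all_analysis.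

Set Implicit Arguments.
Unset Strict Implicit.
Unset Printing Implicit Defensive.

Import Order.TTheory GRing.Theory Num.Theory.
Import numFieldNormedType.Exports.

Local Open Scope classical_set_scope.
Local Open Scope ring_scope.

(* The library norm `|x| on 'rV[R]_d is the max norm, hence this definition. *)
Definition enorm (R : realType) (d : nat) (x : 'rV[R]_d) : R :=
  Num.sqrt (\sum_(i < d) x 0 i ^+ 2).

Definition gradient (R : realType) (d : nat) (f : 'rV[R]_d -> R)
    (x : 'rV[R]_d) : 'rV[R]_d :=
  \row_(i < d) 'D_(delta_mx 0 i) (f : 'rV[R]_d -> R^o) x.

Definition smooth_with (R : realType) (d : nat) (L : R)
    (f : 'rV[R]_d -> R) : Prop :=
  [/\ forall x, differentiable (f : 'rV[R]_d -> R^o) x,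
      continuous (gradient f)
    & forall x y, enorm (gradient f x - gradient f y) <= L * enorm (x - y)].

Definition strongly_convex (R : realType) (d : nat) (mu : R)
    (f : 'rV[R]_d -> R) : Prop :=
  @convex_function R 'rV[R]_d setT (fun x => f x - mu / 2 * enorm x ^+ 2).

Definition is_minimizer (R : realType) (d : nat) (f : 'rV[R]_d -> R)
    (xs : 'rV[R]_d) : Prop :=
  forall x, f xs <= f x.

Definition square_summable (R : realType) (d : nat)
    (w : nat -> 'rV[R]_d) : Prop :=
  (\sum_(0 <= k <oo) (enorm (w k) ^+ 2)%:E < +oo)%E.

(* A method is given by the iterates X x0 w : nat -> R^d it produces from the
   initialization x_0 = x_{-1} = x0 under the gradient errors w.  Both series
   have nonnegative terms when xs minimizes f, so they are taken in \bar R: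
   the inequality forces the left-hand side to be finite. *)
Definition l2_gain_bound (R : realType) (d : nat) (f : 'rV[R]_d -> R)
    (xs : 'rV[R]_d)
    (X : 'rV[R]_d -> (nat -> 'rV[R]_d) -> nat -> 'rV[R]_d)
    (gamma : R) : Prop :=
  exists H : 'rV[R]_d -> R,
    [/\ forall x, 0 <= H x,
        H xs = 0
      & forall (x0 : 'rV[R]_d) (w : nat -> 'rV[R]_d), square_summable w ->
          (\sum_(0 <= k <oo) (f (X x0 w k) - f xs)%:E
           <= (gamma ^+ 2)%:E * \sum_(0 <= k <oo) (enorm (w k) ^+ 2)%:E
              + (H x0)%:E)%E].

(* L_{2,*}; equal to +oo when no finite gamma is suitable. *)
Definition l2_gain (R : realType) (d : nat) (f : 'rV[R]_d -> R)
    (xs : 'rV[R]_d)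
    (X : 'rV[R]_d -> (nat -> 'rV[R]_d) -> nat -> 'rV[R]_d) : \bar R :=
  ereal_inf [set gamma%:E | gamma in
    [set gamma : R | 0 < gamma /\ l2_gain_bound f xs X gamma]].

(* The pair (x_k, x_{k-1}). *)
Fixpoint nag_state (R : realType) (d : nat) (f : 'rV[R]_d -> R)
    (alpha beta : R) (x0 : 'rV[R]_d) (w : nat -> 'rV[R]_d) (k : nat)
    : 'rV[R]_d * 'rV[R]_d :=
  if k is j.+1 then
    let: (x, xprev) := nag_state f alpha beta x0 w j in
    let y := x + beta *: (x - xprev) in
    (x - alpha *: (gradient f y + w j) + beta *: (x - xprev), x)
  else (x0, x0).

Definition nag (R : realType) (d : nat) (f : 'rV[R]_d -> R)
    (alpha beta : R) (x0 : 'rV[R]_d) (w : nat -> 'rV[R]_d) (k : nat)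
    : 'rV[R]_d :=
  (nag_state f alpha beta x0 w k).1.

Definition nag_beta (R : realType) (mu alpha : R) : R :=
  (1 - Num.sqrt (alpha * mu)) / (1 + Num.sqrt (alpha * mu)).

Definition nag_gain_bound (R : realType) (mu L alpha : R) : R :=
  Num.sqrt
    (4 * (5 - 2 * Num.sqrt (alpha * mu) + alpha * mu)
       / (mu * (1 + Num.sqrt (alpha * mu)) ^+ 2)
     + Num.sqrt alpha * (1 + alpha * L) / Num.sqrt mu
     + 8 * alpha ^+ 3 * L ^+ 4 * (4 + (1 - Num.sqrt (alpha * mu)) ^+ 2)
       / (mu ^+ 2 * (1 + Num.sqrt (alpha * mu)) ^+ 2)).

(* Main.v *)
Require Import Defs.
From HB Require Import structures.
From mathcomp Require Import all_boot all_order all_algebra.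
From mathcomp Require Import all_classical all_reals all_analysis.
From mathcomp Require Import ring lra.

(** Put [s = sqrt (alpha mu)] and attach to the iterates the auxiliary sequence
    [z_k = x_k + ((1 - s) / s) (x_k - x_{k-1})].  Then the extrapolated point is
    the average [y_k = (x_k + s z_k) / (1 + s)], and one perturbed step reads
    [x_{k+1} = y_k - alpha h] and
    [z_{k+1} = (1 - s) z_k + s y_k - (alpha / s) h], with
    [h = grad f (y_k) + w_k].

    Without noise the energy [V = f x - f xs + (mu / 2) |z - xs|^2] contracts by
    the factor [1 - s] at every step: add the descent inequality from [y_k] to
    [x_{k+1}], weighted by 1, to the strong convexity inequalities from [y_k] to
    [x_k] and to [xs], weighted by [1 - s] and [s].  With noise the same
    combination leaves two terms linear in [w_k], one against the averaged
    position [(z + s x) / (1 + s) - xs] and one against the gradient, and a term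
    [alpha (1 + alpha L) / 2 * |w_k|^2] ([lyapunov_step]).

    The contraction provides [s V], that is [s (f x - f xs)] and
    [s (mu / 2) |z - xs|^2].  Half of the first part is kept as the output to be
    summed; strong convexity bounds the other half below by a multiple of
    [|x - xs|^2], and this together with the second part pays for the two linear
    terms by Young's inequality, where [|grad f y| <= L |y - xs|]
    ([noise_absorption]).  The cost is a multiple of [|w_k|^2], and dividing by
    [s / 2] gives
    [f x_k - f xs + (2 / s) V_{k+1} <= (2 / s) V_k + gamma^2 |w_k|^2] with
    [gamma] the claimed bound ([nag_dissipation]).  Telescoping yields the
    [l2] gain with [H x0 = (2 / s) V x0 x0], which vanishes at [xs].

    For the expansion at [alpha = 0], [gamma^2 - 20 / mu] is a sum of three
    terms, each at most a constant times [sqrt alpha], and dividing by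
    [gamma + 2 sqrt 5 / sqrt mu] transfers this to [gamma]. *)

Import Order.TTheory GRing.Theory Num.Theory.
Import numFieldNormedType.Exports.
Local Open Scope classical_set_scope.
Local Open Scope ring_scope.

Set Implicit Arguments.
Unset Strict Implicit.
Unset Printing Implicit Defensive.

(** * Euclidean inner product *)

Definition dotv (R : realType) (d : nat) (u v : 'rV[R]_d) : R :=
  \sum_(i < d) u 0 i * v 0 i.

Section DotProduct.
Variables (R : realType) (d : nat).
Implicit Types (u v w : 'rV[R]_d) (c : R).

Lemma dotvC u v : dotv u v = dotv v u.
Proof. by apply: eq_bigr => i _; rewrite mulrC. Qed.

Lemma dotvDl u v w : dotv (u + v) w = dotv u w + dotv v w.
Proof. by rewrite -big_split; apply: eq_bigr => i _; rewrite mxE mulrDl. Qed.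

Lemma dotvZl c u v : dotv (c *: u) v = c * dotv u v.
Proof. by rewrite mulr_sumr; apply: eq_bigr => i _; rewrite mxE mulrA. Qed.

Lemma dotvDr u v w : dotv w (u + v) = dotv w u + dotv w v.
Proof. by rewrite dotvC dotvDl !(dotvC w). Qed.

Lemma dotvZr c u v : dotv v (c *: u) = c * dotv v u.
Proof. by rewrite dotvC dotvZl dotvC. Qed.

Lemma dotv0l v : dotv 0 v = 0.
Proof. by rewrite -(scale0r 0) dotvZl mul0r. Qed.

Lemma dotvNl u v : dotv (- u) v = - dotv u v.
Proof. by rewrite -scaleN1r dotvZl mulN1r. Qed.

Lemma dotvNr u v : dotv v (- u) = - dotv v u.
Proof. by rewrite dotvC dotvNl dotvC. Qed.

Definition dotvE := (dotvDl, dotvDr, dotvNl, dotvNr, dotvZl, dotvZr).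

Lemma dotvv_ge0 u : 0 <= dotv u u.
Proof. by apply: sumr_ge0 => i _; rewrite -expr2 sqr_ge0. Qed.

Lemma dotvv_eq0 u : (dotv u u == 0) = (u == 0).
Proof.
apply/eqP/eqP => [u0 | ->]; last by apply: big1 => i _; rewrite mxE mul0r.
apply/rowP => i; rewrite mxE; apply/eqP; rewrite -sqrf_eq0; apply/eqP.
by apply: (psumr_eq0P _ u0) => // j _; rewrite -expr2 sqr_ge0.
Qed.

Lemma enorm_ge0 u : 0 <= enorm u.
Proof. exact: sqrtr_ge0. Qed.

Lemma enorm_sq u : enorm u ^+ 2 = dotv u u.
Proof.
rewrite /enorm sqr_sqrtr; last by apply: sumr_ge0 => i _; rewrite sqr_ge0.
by apply: eq_bigr => i _; rewrite expr2.
Qed.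

Lemma enormZ c u : enorm (c *: u) = `|c| * enorm u.
Proof.
apply/eqP; rewrite -(eqrXn2 (ltn0Sn 1)) ?mulr_ge0 ?enorm_ge0//.
by rewrite exprMn !enorm_sq dotvZl dotvZr mulrA -expr2 real_normK ?num_real.
Qed.

(** With [a = |v|] and [b = |u|], the square of [a u - b v] is
    [2 a b (a b - <u, v>)]. *)
Lemma cauchy_schwarz u v : dotv u v <= enorm u * enorm v.
Proof.
have [->|u0] := eqVneq u 0.
  by rewrite dotv0l mulr_ge0 ?enorm_ge0.
have [->|v0] := eqVneq v 0.
  by rewrite dotvC dotv0l mulr_ge0 ?enorm_ge0.
have pos (x : 'rV[R]_d) : x != 0 -> 0 < enorm x.
  move=> x0; rewrite lt_neqAle enorm_ge0 andbT eq_sym.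
  by rewrite -sqrf_eq0 enorm_sq dotvv_eq0.
have := dotvv_ge0 (enorm v *: u - enorm u *: v).
rewrite !dotvE -!enorm_sq (dotvC v u).
have := pos u u0; have := pos v v0.
set a := enorm v; set b := enorm u; set c := dotv u v => a0 b0 H.
have {}H : 0 <= (2 * (a * b)) * (b * a - c) by nra.
by move: H; rewrite pmulr_rge0 ?subr_ge0// !mulr_gt0.
Qed.

Lemma young_dotv c u v : 0 < c ->
  2 * dotv u v <= c * dotv u u + c^-1 * dotv v v.
Proof.
move=> c0; have := dotvv_ge0 (c *: u - v); rewrite !dotvE (dotvC v u) => H.
rewrite -subr_ge0 -(pmulr_rge0 _ c0).
have -> : c * (c * dotv u u + c^-1 * dotv v v - 2 * dotv u v) =
  c * (c * dotv u u - dotv u v) - (c * dotv u v - dotv v v).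
  by field; rewrite gt_eqF.
by move: H; lra.
Qed.

End DotProduct.

(** * First-order inequalities for smooth and strongly convex functions *)

Section Smooth.
Variables (R : realType) (d : nat).
Implicit Types (f : 'rV[R]_d -> R) (x y h xs : 'rV[R]_d) (L mu : R).

Lemma derive_dotv f x h : differentiable (f : 'rV[R]_d -> R^o) x ->
  'D_h (f : 'rV[R]_d -> R^o) x = dotv (gradient f x) h.
Proof.
move=> df; rewrite deriveE// {1}(row_sum_delta h) linear_sum.
by apply: eq_bigr => i _; rewrite linearZ mxE deriveE// mulrC.
Qed.

(** This reduces the inequalities below to the one-variable mean value
    theorem. *)
Lemma is_derive_line f x h (t : R) :
  differentiable (f : 'rV[R]_d -> R^o) (x + t *: h) ->
  is_derive t 1 (fun u : R => f (x + u *: h) : R^o)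
    (dotv (gradient f (x + t *: h)) h).
Proof.
move=> df; have quotE : (fun e : R => e^-1 *:
    (((fun u : R => f (x + u *: h) : R^o) \o shift t) (e *: 1)
     - f (x + t *: h))) =
  (fun e : R => e^-1 *: (((f : 'rV[R]_d -> R^o) \o shift (x + t *: h)) (e *: h)
     - f (x + t *: h))).
  apply/funext => e /=; congr (_ *: (f _ - _)).
  by rewrite [e *: 1]mulr1 scalerDl addrCA.
split; first by rewrite /derivable quotE; exact: diff_derivable.
by rewrite -derive_dotv// /derive quotE.
Qed.

Lemma gradientN f : (forall x, differentiable (f : 'rV[R]_d -> R^o) x) ->
  gradient (fun x => - f x) = (fun x => - gradient f x).
Proof.
move=> df; apply/funext => x; apply/rowP => i; rewrite !mxE.
by rewrite deriveN//; exact: diff_derivable.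
Qed.

Lemma smooth_with_opp L f : smooth_with L f ->
  smooth_with L (fun x => - f x).
Proof.
case=> df gc gl; have gN := gradientN df.
split.
- by move=> x; exact: differentiableN.
- by rewrite gN => x; apply: continuousN; exact: gc.
- move=> x y; rewrite gN -opprD.
  by rewrite -scaleN1r enormZ normrN1 mul1r; exact: gl.
Qed.

(** Subtract from [f (x + t h)] the quadratic [t <grad f x, h> + (L / 2) t^2
    |h|^2]: the derivative of the difference is
    [<grad f (x + t h) - grad f x, h> - L t |h|^2], which is nonpositive for
    [t >= 0] by the Cauchy-Schwarz inequality and the Lipschitz bound. *)
Lemma descent_lemma L f x h : smooth_with L f ->
  f (x + h) <= f x + dotv (gradient f x) h + L / 2 * dotv h h.
Proof.
case=> df _ gl.
pose g0 := dotv (gradient f x) h.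
pose psi (t : R) := f (x + t *: h) - (t * g0 + L / 2 * dotv h h * t ^+ 2).
pose dpsi (t : R) := dotv (gradient f (x + t *: h)) h
  - (g0 + L * dotv h h * t).
have dp (t : R) : is_derive t 1 (psi : R -> R^o) (dpsi t).
  have := is_derive_line (df (x + t *: h)) => ?.
  rewrite /psi /dpsi; apply: is_deriveB.
  by apply: is_derive_eq; rewrite /GRing.scale /=; field.
have [c] : exists2 c, c \in `]0, 1[%R & psi 1 - psi 0 = dpsi c * (1 - 0).
  apply: MVT; first exact: ltr01.
  by apply: derivable_within_continuous => u _; have [] := dp u.
rewrite in_itv /= => /andP[c0 _] mvt.
suff dpsi_le0 : dpsi c <= 0.
  move: mvt; rewrite /psi scale1r scale0r addr0 /g0; lra.
have := cauchy_schwarz (gradient f (x + c *: h) - gradient f x) h.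
have := ler_wpM2r (enorm_ge0 h) (gl (x + c *: h) x).
have -> : x + c *: h - x = c *: h by rewrite addrC addKr.
rewrite enormZ (gtr0_norm c0) /dpsi /g0 -enorm_sq !dotvE; lra.
Qed.

(** The descent inequality for [- f], which is smooth with the same constant. *)
Lemma smooth_lower_bound L f x h : smooth_with L f ->
  f x + dotv (gradient f x) h - L / 2 * dotv h h <= f (x + h).
Proof.
move=> sf; have [df _ _] := sf.
have := descent_lemma x h (smooth_with_opp sf).
rewrite (gradientN df) dotvNl; lra.
Qed.

(** At [t = 1] the hypothesis gives [a <= b], so for [a > 0] the value
   [t = a / (2 b)] is admissible, and there it says [a <= a / 2]. *)
Lemma le0_of_le_small_multiples (a b : R) :
  (forall t, 0 < t <= 1 -> a <= t * b) -> a <= 0.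
Proof.
move=> key; rewrite leNgt; apply/negP => a0.
have ab : a <= b by rewrite -[b]mul1r; apply: key; rewrite ltr01 lexx.
have b0 : 0 < b := lt_le_trans a0 ab.
have : a <= a / (2 * b) * b.
  apply: key; rewrite divr_gt0 ?mulr_gt0//= ler_pdivrMr ?mulr_gt0//; lra.
have -> : a / (2 * b) * b = a / 2 by field; rewrite gt_eqF.
lra.
Qed.

(** Convexity of [f - (mu / 2) |.|^2] between [x] and [x + h] bounds
    [f (x + t h)] above, smoothness bounds it below by its linearization up to
    a term of order [t^2]; comparing the two and letting [t] tend to 0 gives the
    claim. *)
Lemma strongly_convex_first_order L mu f x h :
  smooth_with L f -> strongly_convex mu f ->
  f x + dotv (gradient f x) h + mu / 2 * dotv h h <= f (x + h).
Proof.
move=> sf cf.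
have key (t : R) : 0 < t <= 1 ->
    dotv (gradient f x) h + mu / 2 * dotv h h - (f (x + h) - f x)
    <= t * ((L + mu) / 2 * dotv h h).
  move=> /andP[t0 t1].
  have := cf (Itv01 (ltW t0) t1) (x + h) x (in_setT _) (in_setT _).
  rewrite convRE /conv /= /unstable.onem.
  have -> : t *: (x + h) + (1 - t) *: x = x + t *: h.
    by rewrite scalerDr -addrA addrCA -scalerDl subrKC scale1r addrC.
  have := smooth_lower_bound x (t *: h) sf.
  rewrite !enorm_sq !dotvE (dotvC h x).
  move=> H1 H2; rewrite -(ler_pM2l t0); lra.
by have := le0_of_le_small_multiples key; rewrite subr_le0 lerBrDl addrA.
Qed.

(** Otherwise the gradient step of length [1 / L] from [xs] would decrease [f]
    by at least [|grad f xs|^2 / (2 L)]. *)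
Lemma gradient_minimizer f L xs : 0 < L -> smooth_with L f ->
  is_minimizer f xs -> gradient f xs = 0.
Proof.
move=> L0 sf xs_min; apply/eqP; rewrite -dotvv_eq0 eq_le dotvv_ge0 andbT.
have := le_trans (xs_min _) (descent_lemma xs (- L^-1 *: gradient f xs) sf).
rewrite !dotvE; set q := dotv _ _.
have -> : L / 2 * (- L^-1 * (- L^-1 * q)) = L^-1 * q / 2.
  by field; rewrite gt_eqF.
move=> H; have : L^-1 * q <= 0 by lra.
by rewrite pmulr_rle0 ?invr_gt0.
Qed.

End Smooth.

(** * One step of the perturbed accelerated method *)

Section NesterovStep.
Variables (R : realType) (d : nat).
Implicit Types (f : 'rV[R]_d -> R) (x z w g xs : 'rV[R]_d) (L mu alpha s : R).

(** [nag_mid s x z] is the extrapolated point of the method.  With the arguments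
    exchanged it is also the average appearing in the update of [z]:
    [(1 - s) z + s (nag_mid s x z) = nag_mid s z x]. *)
Definition nag_mid s x z : 'rV[R]_d := (1 + s)^-1 *: (x + s *: z).

Definition lyapunov f xs mu x z : R :=
  f x - f xs + mu / 2 * enorm (z - xs) ^+ 2.

(** The difference of the two sides is the sum of five nonnegative terms: the
    descent inequality from [y] to the new [x], the strong convexity
    inequalities from [y] to [x] and to [xs] with weights [1 - s] and [s], a
    multiple of [|x - z|^2] left over by the strong convexity of [f] and of
    [|.|^2], and [(alpha / 2) (1 - alpha L) |g|^2]. *)
Lemma lyapunov_step f L mu alpha s xs x z w
    (y := nag_mid s x z) (g := gradient f y) :
  0 < mu -> 0 < s < 1 -> s ^+ 2 = alpha * mu -> alpha * L <= 1 ->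
  smooth_with L f -> strongly_convex mu f ->
  lyapunov f xs mu (y - alpha *: (g + w))
    ((1 - s) *: z + s *: y - (alpha / s) *: (g + w))
  <= (1 - s) * lyapunov f xs mu x z
     - s * dotv w (nag_mid s (z - xs) (x - xs))
     + alpha ^+ 2 * L * dotv g w
     + alpha / 2 * (1 + alpha * L) * dotv w w.
Proof.
move=> mu0 /andP[s0 s1] s2 aL sf cf.
have aE : alpha = s ^+ 2 / mu by rewrite s2 mulfK// gt_eqF.
have a0 : 0 < alpha by rewrite aE divr_gt0// exprn_gt0.
have s1N : 1 + s != 0 by rewrite gt_eqF// addr_gt0.
(* Center at the minimizer so that everything is a quadratic form in
   [x'], [z'], [g] and [w]. *)
have [x' xE] : exists x', x = x' + xs by exists (x - xs); rewrite subrK.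
have [z' zE] : exists z', z = z' + xs by exists (z - xs); rewrite subrK.
have yE : y = nag_mid s x' z' + xs.
  rewrite /y /nag_mid xE zE; apply/rowP => i; rewrite !mxE; field; exact: s1N.
have descent := descent_lemma y (- alpha *: (g + w)) sf.
have cvx_x := strongly_convex_first_order y (x - y) sf cf.
have cvx_xs := strongly_convex_first_order y (xs - y) sf cf.
have grad_sq : 0 <= alpha / 2 * (1 - alpha * L) * dotv g g.
  by rewrite mulr_ge0 ?dotvv_ge0// mulr_ge0//; lra.
have gap_sq : 0 <= mu * (1 - s ^+ 2) / (2 * s) * (s / (1 + s)) ^+ 2
    * dotv (x' - z') (x' - z').
  rewrite mulr_ge0 ?dotvv_ge0// mulr_ge0 ?sqr_ge0// divr_ge0//; last lra.
  by apply: mulr_ge0; [exact: ltW | rewrite subr_ge0 exprn_ile1// ltW].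
move: descent cvx_x cvx_xs; rewrite -/g !subrKC scaleNr.
have -> : x - y = (s / (1 + s)) *: (x' - z').
  rewrite yE xE /nag_mid; apply/rowP => i; rewrite !mxE; field; exact: s1N.
have -> : xs - y = - nag_mid s x' z' by rewrite yE opprD addrCA subrr addr0.
rewrite /lyapunov !enorm_sq.
have -> : (1 - s) *: z + s *: y - (alpha / s) *: (g + w) - xs =
    nag_mid s z' x' - (alpha / s) *: (g + w).
  rewrite yE zE /nag_mid; apply/rowP => i; rewrite !mxE; field.
  by rewrite s1N gt_eqF.
have -> : z - xs = z' by rewrite zE addrK.
have -> : x - xs = x' by rewrite xE addrK.
rewrite /nag_mid => descent cvx_x cvx_xs; move: descent cvx_x cvx_xs gap_sq.
rewrite !dotvE (dotvC z' x') (dotvC w x') (dotvC w z') (dotvC w g)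
  (dotvC z' g) (dotvC x' g) => descent cvx_x cvx_xs gap_sq.
have s1_ge0 : 0 <= 1 - s by lra.
rewrite -subr_ge0 in descent; rewrite -subr_ge0 in cvx_x.
rewrite -subr_ge0 in cvx_xs.
have := addr_ge0 (addr_ge0 (addr_ge0 (addr_ge0 descent (mulr_ge0 s1_ge0 cvx_x))
  (mulr_ge0 (ltW s0) cvx_xs)) gap_sq) grad_sq.
rewrite -[_ <= _ - _ + _ + _]subr_ge0; congr (is_true (0 <= _)).
by rewrite aE; field; rewrite s1N !gt_eqF.
Qed.

(** [nag_mid s x z] is a convex combination of [x] and [z]. *)
Lemma nag_mid_le s x z : 0 < s ->
  dotv (nag_mid s x z) (nag_mid s x z) <= dotv x x + dotv z z.
Proof.
move=> s0; rewrite /nag_mid !dotvE (dotvC z x) -subr_ge0.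
have q2 : 0 < (1 + s)^-1 ^+ 2 by rewrite exprn_gt0 ?invr_gt0//; lra.
have := dotvv_ge0 x; have := dotvv_ge0 z; have := dotvv_ge0 (x - z).
rewrite !dotvE (dotvC z x).
move: (dotv x x) (dotv x z) (dotv z z) => xx xz zz H zz0 xx0.
have -> : xx + zz - (1 + s)^-1 * ((1 + s)^-1 * (xx + s * xz)
    + s * ((1 + s)^-1 * (xz + s * zz))) =
  (1 + s)^-1 ^+ 2 * (s * (xx - xz + (- xz - - zz))
    + (s + s ^+ 2) * xx + (1 + s) * zz).
  by field; rewrite gt_eqF//; lra.
apply: mulr_ge0; first exact: ltW.
apply: addr_ge0; last by apply: mulr_ge0 => //; lra.
by apply: addr_ge0; apply: mulr_ge0 => //; nra.
Qed.

(** [(1 + beta)^2 + beta^2] for the momentum [beta = (1 - s) / (1 + s)]; both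
    the first and the last summand of the squared gain bound are multiples of
    it. *)
Definition nag_weight s : R := (4 + (1 - s) ^+ 2) / (1 + s) ^+ 2.

Lemma nag_weight_ge1 s : 0 < s < 1 -> 1 <= nag_weight s.
Proof.
by move=> /andP[s0 s1]; rewrite ler_pdivlMr ?mul1r ?exprn_gt0//; nra.
Qed.

(** [5 - nag_weight s = (12 s + 4 s^2) / (1 + s)^2]. *)
Lemma nag_weight_near5 s : 0 <= s -> s <= 1 ->
  nag_weight s <= 5 /\ 5 <= nag_weight s + 16 * s.
Proof.
move=> s0 s1; have s1p : 0 < (1 + s) ^+ 2 by rewrite exprn_gt0//; lra.
by split; rewrite /nag_weight ?ler_pdivrMr// -?lerBlDr ?ler_pdivlMr//; nra.
Qed.

Lemma nag_weight_ge0 s : 0 <= nag_weight s.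
Proof. by rewrite divr_ge0 ?sqr_ge0// addr_ge0 ?sqr_ge0. Qed.

(** Young's inequality, with the available energy split as follows:
    [(mu / 4) (|x|^2 + |z|^2)], which dominates [(mu / 4) |y|^2], is spent on
    the gradient term, and [(mu / 4) |x|^2 + (3 mu / 4) |z|^2] on the two
    components of [p]. *)
Lemma noise_absorption L mu alpha s x z w g
    (y := nag_mid s x z) (p := nag_mid s z x) :
  0 < mu -> 0 < L -> 0 < s < 1 -> s ^+ 2 = alpha * mu ->
  dotv g g <= L ^+ 2 * dotv y y ->
  2 * (alpha ^+ 2 * L * dotv g w - s * dotv w p) <=
  s * (mu / 2 * dotv x x + mu * dotv z z
    + (4 * nag_weight s / mu + 8 * alpha ^+ 3 * L ^+ 4 * nag_weight s / mu ^+ 2)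
      * dotv w w).
Proof.
move=> mu0 L0 s01 s2 gL; have /andP[s0 s1] := s01.
have ww0 := dotvv_ge0 w.
have aE : alpha = s ^+ 2 / mu by rewrite s2 mulfK// gt_eqF.
have a0 : 0 < alpha by rewrite aE divr_gt0// exprn_gt0.
have s1N : 1 + s != 0 by rewrite gt_eqF// addr_gt0.
have grad_part : 2 * (alpha ^+ 2 * L * dotv g w) <=
  s * (mu / 4 * (dotv x x + dotv z z)
    + 4 * alpha ^+ 3 * L ^+ 4 / mu ^+ 2 * dotv w w).
  (* This weight turns [|g|^2 <= L^2 |y|^2] into [s (mu / 4) |y|^2]. *)
  have k0 : 0 < s * mu / (4 * L ^+ 2) by rewrite divr_gt0 ?mulr_gt0 ?exprn_gt0.
  have := young_dotv g ((alpha ^+ 2 * L) *: w) k0.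
  rewrite !dotvE => H; apply: (le_trans H).
  rewrite mulrDr; apply: lerD.
    apply: (le_trans (ler_wpM2l (ltW k0) gL)).
    have -> : s * mu / (4 * L ^+ 2) * (L ^+ 2 * dotv y y)
      = s * (mu / 4 * dotv y y) by field; rewrite gt_eqF.
    by rewrite !ler_pM2l ?divr_gt0//; exact: nag_mid_le.
  rewrite le_eqVlt; apply/orP; left; apply/eqP.
  by rewrite aE; field; rewrite !gt_eqF.
have mid_part : - 2 * dotv w p <=
  mu / 4 * dotv x x + 3 * mu / 4 * dotv z z + 4 * nag_weight s / mu * dotv w w.
  have mu4 : 0 < mu / 4 by lra.
  have mu34 : 0 < 3 * mu / 4 by lra.
  have Hz := young_dotv z (- (1 + s)^-1 *: w) mu34.
  have Hx := young_dotv x (- (s / (1 + s)) *: w) mu4.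
  have : (4 / 3 + 4 * s ^+ 2) / (mu * (1 + s) ^+ 2) * dotv w w <=
    4 * nag_weight s / mu * dotv w w.
    apply: ler_wpM2r => //; rewrite -subr_ge0.
    have -> : 4 * nag_weight s / mu
        - (4 / 3 + 4 * s ^+ 2) / (mu * (1 + s) ^+ 2) =
      (56 / 3 - 8 * s) / (mu * (1 + s) ^+ 2).
      by rewrite /nag_weight; field; rewrite s1N gt_eqF.
    by rewrite divr_ge0 ?mulr_ge0 ?sqr_ge0 ?(ltW mu0)//; lra.
  move: Hz Hx; rewrite /p /nag_mid !dotvE (dotvC w x) (dotvC w z).
  set ww := dotv w w; set xw := dotv x w; set zw := dotv z w.
  have -> : (4 / 3 + 4 * s ^+ 2) / (mu * (1 + s) ^+ 2) * ww =
   (3 * mu / 4)^-1 * (- (1 + s)^-1 * (- (1 + s)^-1 * ww)) +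
   (mu / 4)^-1 * (- (s / (1 + s)) * (- (s / (1 + s)) * ww)).
    by field; rewrite s1N gt_eqF.
  lra.
have := nag_weight_ge1 s01; set D := nag_weight s => D1.
have : 4 * alpha ^+ 3 * L ^+ 4 / mu ^+ 2 * dotv w w <=
   8 * alpha ^+ 3 * L ^+ 4 * D / mu ^+ 2 * dotv w w.
  apply: ler_wpM2r => //.
  rewrite ler_pM2r ?invr_gt0 ?exprn_gt0// -subr_ge0.
  have -> : 8 * alpha ^+ 3 * L ^+ 4 * D - 4 * alpha ^+ 3 * L ^+ 4 =
    alpha ^+ 3 * L ^+ 4 * (8 * D - 4) by ring.
  apply: mulr_ge0; last lra.
  by apply: mulr_ge0; apply: exprn_ge0; exact: ltW.
rewrite -(ler_pM2l s0) => D3; rewrite -(ler_pM2l s0) in mid_part.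
move: grad_part mid_part D3; rewrite -/D; lra.
Qed.

(** * Gain of the method *)

Definition nag_aux f mu alpha (x0 : 'rV[R]_d) (w : nat -> 'rV[R]_d) k
    : 'rV[R]_d :=
  let: (x, xprev) := nag_state f alpha (nag_beta mu alpha) x0 w k in
  let s := Num.sqrt (alpha * mu) in
  x + ((1 - s) / s) *: (x - xprev).

Lemma nag_aux0 f mu alpha x0 (w : nat -> 'rV[R]_d) :
  nag_aux f mu alpha x0 w 0 = x0.
Proof. by rewrite /nag_aux /= subrr scaler0 addr0. Qed.

(** The momentum form of the method is the coupled recursion to which
    [lyapunov_step] applies; this is where the choice of [beta] enters. *)
Lemma nag_rec f mu alpha x0 (w : nat -> 'rV[R]_d) k
    (s := Num.sqrt (alpha * mu)) (x := nag f alpha (nag_beta mu alpha) x0 w)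
    (z := nag_aux f mu alpha x0 w) (y := nag_mid s (x k) (z k))
    (h := gradient f y + w k) :
  0 < s ->
  x k.+1 = y - alpha *: h
  /\ z k.+1 = (1 - s) *: z k + s *: y - (alpha / s) *: h.
Proof.
move=> s0; have s1N : 1 + s != 0 by rewrite gt_eqF// addr_gt0.
have sN : s != 0 by rewrite gt_eqF.
rewrite /h /y /x /z /nag /nag_aux /= -/s.
case: (nag_state _ _ _ _ _ k) => a b /=.
have -> : nag_mid s a (a + ((1 - s) / s) *: (a - b)) =
    a + nag_beta mu alpha *: (a - b).
  rewrite /nag_mid /nag_beta -/s; apply/rowP => i; rewrite !mxE; field.
  by rewrite s1N sN.
rewrite /nag_beta -/s; set g := gradient _ _; split.
  by rewrite addrAC.
apply/rowP => i; rewrite !mxE; field.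
by rewrite s1N sN.
Qed.

(** [alpha mu <= mu / L < 1]. *)
Lemma nag_rate_in01 mu L alpha : 0 < mu -> mu < L -> 0 < alpha <= 1 / L ->
  0 < Num.sqrt (alpha * mu) < 1.
Proof.
move=> mu0 muL /andP[a0]; rewrite ler_pdivlMr ?(lt_trans mu0 muL)// => aL.
have am0 : 0 < alpha * mu := mulr_gt0 a0 mu0.
rewrite sqrtr_gt0 am0 -[ltRHS]sqrtr1 ltr_sqrt//; nra.
Qed.

Lemma noise_coeff_ge0 mu L alpha s : 0 <= mu -> 0 <= L -> 0 <= alpha ->
  0 <= 4 * nag_weight s / mu
       + 8 * alpha ^+ 3 * L ^+ 4 * nag_weight s / mu ^+ 2.
Proof.
move=> mu0 L0 a0; have := exprn_ge0 3 a0; have := exprn_ge0 4 L0.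
have := nag_weight_ge0 s.
move: (nag_weight s) (alpha ^+ 3) (L ^+ 4) => D a3 L4 D0 L40 a30.
by rewrite addr_ge0 ?divr_ge0 ?mulr_ge0 ?sqr_ge0.
Qed.

(** The decomposition of the squared bound produced by [lyapunov_step], through
    [sqrt alpha / sqrt mu = alpha / s], and by [noise_absorption]. *)
Lemma nag_gain_bound_sq mu L alpha (s := Num.sqrt (alpha * mu)) :
  0 < mu -> 0 < L -> 0 < alpha -> 0 < s < 1 ->
  nag_gain_bound mu L alpha ^+ 2 =
  alpha / s * (1 + alpha * L)
  + (4 * nag_weight s / mu + 8 * alpha ^+ 3 * L ^+ 4 * nag_weight s / mu ^+ 2).
Proof.
move=> mu0 L0 a0 /andP[s0 s1].
have sE : s = Num.sqrt alpha * Num.sqrt mu by rewrite /s sqrtrM// ltW.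
have E : 4 * (5 - 2 * s + alpha * mu) / (mu * (1 + s) ^+ 2)
    + Num.sqrt alpha * (1 + alpha * L) / Num.sqrt mu
    + 8 * alpha ^+ 3 * L ^+ 4 * (4 + (1 - s) ^+ 2) / (mu ^+ 2 * (1 + s) ^+ 2)
  = alpha / s * (1 + alpha * L)
  + (4 * nag_weight s / mu + 8 * alpha ^+ 3 * L ^+ 4 * nag_weight s / mu ^+ 2).
  have -> : alpha * mu = s ^+ 2 by rewrite sqr_sqrtr// mulr_ge0// ltW.
  have -> : alpha / s = Num.sqrt alpha / Num.sqrt mu.
    rewrite sE -[X in X / _](sqr_sqrtr (ltW a0)); field.
    by rewrite !gt_eqF ?sqrtr_gt0.
  rewrite /nag_weight; field.
  by rewrite !gt_eqF ?sqrtr_gt0//; lra.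
rewrite /nag_gain_bound -/s E sqr_sqrtr//.
apply: addr_ge0; last exact: noise_coeff_ge0 (ltW mu0) (ltW L0) (ltW a0).
by rewrite mulr_ge0 ?divr_ge0 ?addr_ge0 ?mulr_ge0// ltW.
Qed.

Lemma nag_gain_bound_gt0 mu L alpha :
  0 < mu -> mu < L -> 0 < alpha <= 1 / L -> 0 < nag_gain_bound mu L alpha.
Proof.
move=> mu0 muL aL; have L0 : 0 < L := lt_trans mu0 muL.
have s01 := nag_rate_in01 mu0 muL aL; have /andP[s0 s1] := s01.
have /andP[a0 _] := aL.
rewrite lt_neqAle sqrtr_ge0 andbT eq_sym -sqrf_eq0 nag_gain_bound_sq// gt_eqF//.
apply: ltr_wpDr; first exact: noise_coeff_ge0 (ltW mu0) (ltW L0) (ltW a0).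
by rewrite mulr_gt0 ?divr_gt0 ?addr_gt0 ?mulr_gt0.
Qed.

(** Twice [lyapunov_step], in which [2 s V] supplies [s (f x - f xs)] for the
    left-hand side and, by the quadratic growth of [f] around [xs], the energy
    that [noise_absorption] consumes; then divide by [s]. *)
Lemma nag_dissipation f L mu alpha xs x0 (w : nat -> 'rV[R]_d) k
    (s := Num.sqrt (alpha * mu)) (x := nag f alpha (nag_beta mu alpha) x0 w)
    (z := nag_aux f mu alpha x0 w) :
  0 < mu -> mu < L -> 0 < alpha <= 1 / L ->
  smooth_with L f -> strongly_convex mu f -> is_minimizer f xs ->
  f (x k) - f xs + 2 / s * lyapunov f xs mu (x k.+1) (z k.+1) <=
  2 / s * lyapunov f xs mu (x k) (z k)
  + nag_gain_bound mu L alpha ^+ 2 * enorm (w k) ^+ 2.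
Proof.
move=> mu0 muL aL0 sf cf xs_min.
have L0 : 0 < L := lt_trans mu0 muL.
have s01 : 0 < s < 1 := nag_rate_in01 mu0 muL aL0.
have /andP[s0 s1] := s01; have /andP[a0 aL] := aL0.
rewrite ler_pdivlMr// in aL.
have s2 : s ^+ 2 = alpha * mu by rewrite sqr_sqrtr// mulr_ge0// ltW.
have grad0 := gradient_minimizer L0 sf xs_min.
rewrite /x /z; have [-> ->] := nag_rec f x0 w k s0; rewrite -/s -/x -/z.
set y := nag_mid s (x k) (z k).
have step := lyapunov_step xs (x k) (z k) (w k) mu0 s01 s2 aL sf cf.
have y_centered : y - xs = nag_mid s (x k - xs) (z k - xs).
  rewrite /y /nag_mid; apply/rowP => i; rewrite !mxE; field.
  by rewrite gt_eqF//; lra.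
have gL : dotv (gradient f y) (gradient f y) <=
    L ^+ 2 * dotv (y - xs) (y - xs).
  rewrite -!enorm_sq -exprMn; have [_ _ /(_ y xs)] := sf.
  by rewrite grad0 subr0 => ?; rewrite lerXn2r// nnegrE ?enorm_ge0//
    mulr_ge0 ?enorm_ge0// ltW.
rewrite y_centered in gL.
have noise := noise_absorption (w k) mu0 L0 s01 s2 gL.
have growth := strongly_convex_first_order xs (x k - xs) sf cf.
rewrite grad0 subrKC dotv0l addr0 in growth.
rewrite nag_gain_bound_sq// -/s.
have VE : lyapunov f xs mu (x k) (z k) =
    f (x k) - f xs + mu / 2 * dotv (z k - xs) (z k - xs).
  by rewrite /lyapunov enorm_sq.
rewrite enorm_sq.
move: step noise; rewrite -/y.
set Vn := lyapunov _ _ _ (_ - _) _; move: VE.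
set V := lyapunov _ _ _ _ _ => VE step noise.
rewrite -(ler_pM2l s0).
set lhs := (X in X <= _); set rhs := (X in _ <= X).
have -> : lhs = s * (f (x k) - f xs) + 2 * Vn.
  by rewrite /lhs; field; rewrite gt_eqF.
set D := 4 * _ / _ + _ in rhs noise *.
have -> : rhs = 2 * V + (alpha * (1 + alpha * L) + s * D) * dotv (w k) (w k).
  by rewrite /rhs; field; rewrite gt_eqF.
rewrite -(ler_pM2l s0) in growth.
move: step noise; rewrite VE; lra.
Qed.

End NesterovStep.

(** Telescope the first [n] inequalities, drop [V n], and let [n] grow. *)
Lemma nneseries_dissipation (R : realType) (a b V : nat -> R) :
  (forall k, 0 <= a k) -> (forall k, 0 <= b k) -> (forall k, 0 <= V k) ->
  (forall k, a k + V k.+1 <= V k + b k) ->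
  (\sum_(0 <= k <oo) (a k)%:E <= \sum_(0 <= k <oo) (b k)%:E + (V 0%N)%:E)%E.
Proof.
move=> a0 b0 V0 dissip.
have partial n : \sum_(0 <= k < n) a k + V n <= \sum_(0 <= k < n) b k + V 0%N.
  elim: n => [|n ih]; first by rewrite !big_geq.
  rewrite !big_nat_recr//=; have := dissip n; move: ih; lra.
apply: lime_le.
  by apply: is_cvg_nneseries => n _ _; rewrite lee_fin.
apply: nearW => n.
apply: (@le_trans _ _ (\sum_(0 <= k < n) (b k)%:E + (V 0%N)%:E)%E).
  rewrite !sumEFin -EFinD lee_fin; have := partial n; have := V0 n; lra.
by rewrite leeD2r//; apply: nneseries_lim_ge => k _ _; rewrite lee_fin.
Qed.

Lemma nag_l2_gain_bound (R : realType) (d : nat) (mu L alpha : R)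
    (f : 'rV[R]_d -> R) (xs : 'rV[R]_d) :
  0 < mu -> mu < L -> 0 < alpha <= 1 / L ->
  smooth_with L f -> strongly_convex mu f -> is_minimizer f xs ->
  l2_gain_bound f xs (nag f alpha (nag_beta mu alpha))
    (nag_gain_bound mu L alpha).
Proof.
move=> mu0 muL aL sf cf xs_min; have /andP[a0 _] := aL.
pose s := Num.sqrt (alpha * mu).
have s0 : 0 < s by rewrite sqrtr_gt0 mulr_gt0.
have V_ge0 x z : 0 <= 2 / s * lyapunov f xs mu x z.
  apply: mulr_ge0; first by rewrite divr_ge0// ltW.
  by rewrite addr_ge0 ?subr_ge0// mulr_ge0 ?sqr_ge0// divr_ge0// ltW.
exists (fun x => 2 / s * lyapunov f xs mu x x); split.
- by move=> x; exact: V_ge0.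
- by rewrite /lyapunov !subrr enorm_sq dotv0l !(mulr0, addr0).
- move=> x0 w _.
  rewrite -nneseriesZl//; last by move=> k _; rewrite lee_fin sqr_ge0.
  under [X in (_ <= X + _)%E]eq_eseriesr do rewrite -EFinM.
  rewrite -{3}(nag_aux0 f mu alpha x0 w).
  apply: (nneseries_dissipation (V := fun k =>
    2 / s * lyapunov f xs mu (nag f alpha (nag_beta mu alpha) x0 w k)
      (nag_aux f mu alpha x0 w k))) => k.
  + by rewrite subr_ge0.
  + by rewrite mulr_ge0 ?sqr_ge0.
  + exact: V_ge0.
  + exact: (nag_dissipation x0 w k mu0 muL aL sf cf xs_min).
Qed.

(** * Small stepsizes *)

(** The bound is a square root, so it is compared with its limit [c] through
    [gamma - c = (gamma^2 - c^2) / (gamma + c)], where [gamma + c >= c > 0]. *)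
Lemma nag_gain_bound_asymptotics (R : realType) (mu L : R) :
  0 < mu -> mu < L ->
  (nag_gain_bound mu L : R -> R^o)
  = cst (2 * Num.sqrt 5 / Num.sqrt mu) +O_ (0^'+)
      ((fun alpha : R => Num.sqrt alpha) : R -> R^o).
Proof.
move=> mu0 muL; have L0 : 0 < L := lt_trans mu0 muL.
set c := 2 * Num.sqrt 5 / Num.sqrt mu.
have rmu0 : 0 < Num.sqrt mu by rewrite sqrtr_gt0.
have c0 : 0 < c by rewrite divr_gt0 ?mulr_gt0 ?sqrtr_gt0.
have c2 : c ^+ 2 = 20 / mu.
  rewrite /c !exprMn exprVn !sqr_sqrtr ?(ltW mu0)//; congr (_ / _); ring.
(* The sum of the constants of [noise_part], [weight_part] and [grad_part]. *)
pose K := (65 + L) / Num.sqrt mu + 40 * L ^+ 4 / mu ^+ 2.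
apply/eqaddOP; apply/bigO_exP; exists (K / c).
  by rewrite divr_gt0// addr_gt0 ?divr_gt0 ?mulr_gt0 ?addr_gt0 ?exprn_gt0.
near=> alpha.
have a0 : 0 < alpha by near: alpha; exact: nbhs_right_gt.
have a1 : alpha <= 1 by near: alpha; apply: nbhs_right_le.
have aL : alpha <= 1 / L by near: alpha; apply: nbhs_right_le; rewrite divr_gt0.
have s01 : 0 < Num.sqrt (alpha * mu) < 1.
  by apply: nag_rate_in01 mu0 muL _; rewrite a0.
have /andP[s0 s1] := s01.
have gamma0 : 0 < nag_gain_bound mu L alpha.
  by apply: nag_gain_bound_gt0 => //; rewrite a0.
have key : `|nag_gain_bound mu L alpha ^+ 2 - c ^+ 2| <= K * Num.sqrt alpha.
  rewrite nag_gain_bound_sq// c2; set s := Num.sqrt (alpha * mu).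
  set r := Num.sqrt alpha; set m := Num.sqrt mu.
  have r0 : 0 < r by rewrite sqrtr_gt0.
  have r2 : r ^+ 2 = alpha by rewrite sqr_sqrtr// ltW.
  have m2 : m ^+ 2 = mu by rewrite sqr_sqrtr// ltW.
  have r1 : r <= 1 by rewrite -[leRHS]sqrtr1 ler_wsqrtr.
  have sE : s = r * m by rewrite /s sqrtrM// ltW.
  have [D_ge D_le] := nag_weight_near5 (ltW s0) (ltW s1).
  set D := nag_weight s; set T := 8 * _ * _ * _ / _.
  have noise_part : 0 <= alpha / s * (1 + alpha * L) <= (1 + L) / m * r.
    have -> : alpha / s = r / m.
      by rewrite sE -r2; field; rewrite !gt_eqF.
    rewrite mulr_ge0 ?divr_ge0 ?addr_ge0 ?mulr_ge0 ?(ltW r0) ?(ltW rmu0)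
      ?(ltW a0) ?(ltW L0)//=.
    rewrite (_ : _ / m * r = r / m * (1 + L)); last by ring.
    rewrite ler_wpM2l ?divr_ge0 ?(ltW r0) ?(ltW rmu0)// lerD2l.
    by rewrite ler_piMl// ltW.
  have weight_part : 0 <= 20 / mu - 4 * D / mu <= 64 / m * r.
    have -> : 20 / mu - 4 * D / mu = 4 / mu * (5 - D) by ring.
    have -> : 64 / m * r = 4 / mu * (16 * s).
      by rewrite sE -m2; field; rewrite gt_eqF.
    have mu4 : 0 <= 4 / mu by rewrite divr_ge0// ltW.
    by rewrite mulr_ge0 ?subr_ge0//= ler_wpM2l// lerBlDl.
  have grad_part : 0 <= T <= 40 * L ^+ 4 / mu ^+ 2 * r.
    have c3 : 0 <= 8 * L ^+ 4 / mu ^+ 2.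
      by rewrite divr_ge0 ?sqr_ge0// mulr_ge0// exprn_ge0// ltW.
    have -> : T = 8 * L ^+ 4 / mu ^+ 2 * (alpha ^+ 3 * D) by rewrite /T; ring.
    have -> : 40 * L ^+ 4 / mu ^+ 2 * r = 8 * L ^+ 4 / mu ^+ 2 * (r * 5).
      by ring.
    have a3 : 0 <= alpha ^+ 3 <= r.
      rewrite exprn_ge0 ?(ltW a0)//= -r2 -exprM.
      by rewrite -[leRHS]expr1 ler_wiXn2l// ltW.
    have /andP[a3_ge0 a3_le] := a3.
    have aD : 0 <= alpha ^+ 3 * D by rewrite mulr_ge0 ?nag_weight_ge0.
    by rewrite (mulr_ge0 c3 aD)/= ler_wpM2l// ler_pM// nag_weight_ge0.
  rewrite ler_norml /K.
  move: noise_part weight_part grad_part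
    => /andP[n0 n1] /andP[w0 w1] /andP[t0 t1].
  have := le_trans n0 n1; have := le_trans w0 w1; have := le_trans t0 t1.
  have -> : ((65 + L) / m + 40 * L ^+ 4 / mu ^+ 2) * r =
    (1 + L) / m * r + 64 / m * r + 40 * L ^+ 4 / mu ^+ 2 * r by ring.
  by move=> *; apply/andP; split; lra.
rewrite -[(_ - cst c) alpha]/(nag_gain_bound mu L alpha - c).
rewrite (ger0_norm (sqrtr_ge0 _)) mulrAC ler_pdivlMr//.
apply: le_trans key; rewrite subr_sqr normrM ler_wpM2l//.
by rewrite ger0_norm ?addr_ge0 ?ltW// ltr_pwDl.
Unshelve. all: by end_near.
Qed.

Theorem proposition5p3 (R : realType) (d : nat) (mu L : R)
    (f : 'rV[R]_d -> R) (xs : 'rV[R]_d)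
    (mu_gt0 : 0 < mu) (mu_lt_L : mu < L)
    (f_strongly_convex : strongly_convex mu f)
    (f_smooth : smooth_with L f)
    (xs_min : is_minimizer f xs) :
  (forall alpha : R, 0 < alpha <= 1 / L ->
     (l2_gain f xs (nag f alpha (nag_beta mu alpha))
      <= (nag_gain_bound mu L alpha)%:E)%E)
  /\ (nag_gain_bound mu L : R -> R^o)
     = cst (2 * Num.sqrt 5 / Num.sqrt mu) +O_ (0^'+)
         ((fun alpha : R => Num.sqrt alpha) : R -> R^o).
Proof.
split; last exact: nag_gain_bound_asymptotics.
move=> alpha aL; apply: ereal_inf_lbound.
exists (nag_gain_bound mu L alpha) => //; split.
  exact: nag_gain_bound_gt0.
exact: nag_l2_gain_bound.
Qed.
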